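(* Let $d=1$. Let $X_1,\dots,X_n$ be i.i.d. with law $\mathbb{P}_X=(1-\epsilon)P_{\theta^*}+\epsilon\mathbb{Q}_X$ for some $\theta^*\in\Theta$, some distribution $\mathbb{Q}_X$ on $\mathbb{R}$ and $\epsilon\in[0,1]$, and let $M_1,\dots,M_n\in\{0,1\}$ be i.i.d., independent of the $X_i$, with $\mathbb{P}[M_i=0]=\alpha$ (MCAR; $M_i=0$ means $X_i$ selected for observation). Let $0<\varepsilon<\alpha$. An adversary replaces $(M_i)$ by $(\widetilde M_i)$, possibly depending on the whole sample, such that $|\{i:\widetilde M_i\neq M_i\}|\le|\{i:M_i=0\}|\cdot\varepsilon/\alpha$, and only $\{X_i:\widetilde M_i=0\}$ is observed. Let $\theta_n^{\mathrm{MMD}}\in\arg\min_{\theta\in\Theta}\mathbb{D}(\widetilde P_n,P_\theta)$, where $\widetilde P_n=\frac{1}{|\{i:\widetilde M_i=0\}|}\sum_{i:\widetilde M_i=0}\delta_{\{X_i\}}$. Then $$ \mathbb{E}_{\mathcal{S}}\big[\mathbb{D}(P_{\theta^*},P_{\theta_n^{\mathrm{MMD}}})\big]\le 4\epsilon+\frac{6\varepsilon}{\alpha-\varepsilon}+\frac{2\sqrt2}{\sqrt{n\alpha}}, $$ where $\mathbb{E}_{\mathcal{S}}$ is the expectation over the sample $\{(X_i,M_i)\}_{1\le i\le n}$.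
   Context: $\{P_\theta:\theta\in\Theta\}$ is a model on $\mathbb{R}$. $k$ is a positive definite kernel on $\mathbb{R}$ bounded by $1$ and characteristic, with RKHS $\mathcal{H}$, mean embedding $\Phi(Q)=\mathbb{E}_{Y\sim Q}[k(Y,\cdot)]$, MMD $\mathbb{D}(Q_1,Q_2)=\|\Phi(Q_1)-\Phi(Q_2)\|_{\mathcal{H}}$. Empirical measures with an empty index set are interpreted with denominator $\max(1,\cdot)$. *)

(* Defs.v *)
From HB Require Import structures.
From mathcomp Require Import all_boot all_order all_algebra.
From mathcomp Require Import all_classical all_reals all_analysis.
Set Implicit Arguments. Unset Strict Implicit. Unset Printing Implicit Defensive.
Import Order.TTheory GRing.Theory Num.Theory.
Local Open Scope ring_scope.
Local Open Scope classical_set_scope.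

Section Defs.
Variable R : realType.

(* <Phi(mu), Phi(nu)>_H = \int\int k(x,y) dmu(x) dnu(y) (reproducing property) *)
Definition kint (k : R -> R -> R) (mu nu : {measure set R -> \bar R}) : R :=
  fine (\int[mu]_x (\int[nu]_y (k x y)%:E))%E.

(* MMD(mu,nu) = || Phi(mu) - Phi(nu) ||_H, written out via the inner products *)
Definition MMD (k : R -> R -> R) (mu nu : {measure set R -> \bar R}) : R :=
  Num.sqrt (kint k mu mu - kint k mu nu - kint k nu mu + kint k nu nu).

Definition kernel_measurable (k : R -> R -> R) : Prop :=
  measurable_fun setT (fun p : R * R => k p.1 p.2).

Definition pos_def_kernel (k : R -> R -> R) : Prop :=
  (forall x y, k x y = k y x) /\
  forall (m : nat) (c x : 'I_m -> R),
    0 <= \sum_(i < m) \sum_(j < m) c i * c j * k (x i) (x j).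

Definition kernel_bounded_by_1 (k : R -> R -> R) : Prop :=
  forall x y, `|k x y| <= 1.

Definition characteristic (k : R -> R -> R) : Prop :=
  forall P Q : probability R R, MMD k P Q = 0 ->
    forall A, measurable A -> P A = Q A.

(* Empirical measure of the points x_i with m_i = false (i.e. M_i = 0),
   normalised by max(1, #{i : m_i = false}). *)
Definition emp (n : nat) (x : 'I_n -> R) (m : 'I_n -> bool)
  : {measure set R -> \bar R} :=
  mscale ((maxn 1 #|[set i | ~~ m i]|)%:R^-1)%:nng
    (msum (fun j : nat => match @insub nat (fun j => (j < n)%N) 'I_n j with
                          | Some i => if m i then (mzero : {measure set R -> \bar R})
                                      else (\d_(x i) : {measure set R -> \bar R})
                          | None => (mzero : {measure set R -> \bar R})
                          end) n).

(* (X_i, M_i)_{i<n}: X_i i.i.d. with law PX, M_i i.i.d. in {0,1} (false = 0,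
   true = 1) with P[M_i = 0] = alpha, all 2n variables mutually independent. *)
Definition MCAR_sample d (Omega : measurableType d) (P : probability Omega R)
  (n : nat) (X : 'I_n -> Omega -> R) (M : 'I_n -> Omega -> bool)
  (PX : set R -> \bar R) (alpha : R) : Prop :=
  [/\ (forall i, measurable_fun setT (X i)),
      (forall i (b : bool), measurable (M i @^-1` [set b])),
      (forall (A : 'I_n -> set R) (B : 'I_n -> set bool),
          (forall i, measurable (A i)) ->
          P (\bigcap_(i in [set: 'I_n]) (X i @^-1` A i `&` M i @^-1` B i)) =
          (\prod_(i < n) (P (X i @^-1` A i) * P (M i @^-1` B i)))%E),
      (forall i A, measurable A -> P (X i @^-1` A) = PX A) &
      (forall i, P (M i @^-1` [set false]) = alpha%:E)].

End Defs.

(* Main.v *)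
Require Import Defs.
From HB Require Import structures.
From mathcomp Require Import all_boot all_order all_algebra.
From mathcomp Require Import all_classical all_reals all_analysis.
From mathcomp Require Import measurable_realfun zify ring lra.
Set Implicit Arguments. Unset Strict Implicit. Unset Printing Implicit Defensive.
Import Order.TTheory GRing.Theory Num.Theory.
Local Open Scope ring_scope.
Local Open Scope classical_set_scope.

(* Since theta_hat is a minimiser, D(P_star, P_hat) <= 2 D(P~_n, P_star), and the triangle
   inequality through the uncorrupted empirical measure P_n and the law P_X splits
   D(P~_n, P_star) into three terms.  D(P_X, P_star) <= 2 eps, and D(P~_n, P_n) is at most the
   l^1 distance of the two weight vectors, hence at most 2 veps / (alpha - veps).  On
   the event that exactly the indices in S are observed, the X_i are still i.i.d., so
   E D(P_n, P_X)^2 <= E[1 / max(1, #|S|)] <= 2 / (n alpha) by a binomial identity.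

   The RKHS is replaced by the quadratic form of k on finite combinations of probability
   measures.  Its positivity follows from that of k on atoms by trading the atoms one by
   one for measures (law of large numbers in mean square). *)

(** * Finite signed combinations of probability measures *)

Section BoundedMeasurable.
Context {R : realType} {d : measure_display} {T : measurableType d}.
Implicit Types (f g : T -> R) (s t : seq (R * probability T R)).

(** These functions are integrable against every finite measure and include all sections of a
    bounded measurable kernel, so on them [lint] is linear and real-valued. *)
Definition bmf f := measurable_fun setT f /\ exists C, forall x, `|f x| <= C.

Lemma bmf_cst (c : R) : bmf (fun _ => c).
Proof. by split; [exact: measurable_cst | exists `|c|]. Qed.

Lemma bmfD f g : bmf f -> bmf g -> bmf (fun x => f x + g x).
Proof.
move=> [mf [C hC]] [mg [D hD]]; split; first exact: measurable_funD.
by exists (C + D) => x; rewrite (le_trans (ler_normD _ _))// lerD.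
Qed.

Lemma bmfZ (c : R) f : bmf f -> bmf (fun x => c * f x).
Proof.
move=> [mf [C hC]]; split; first exact: measurable_funM.
by exists (`|c| * C) => x; rewrite normrM ler_wpM2l.
Qed.

Lemma bmf_sum (I : Type) (r : seq I) (p : pred I) (F : I -> T -> R) :
  (forall i, bmf (F i)) -> bmf (fun x => \sum_(i <- r | p i) F i x).
Proof.
move=> hF; elim: r => [|i r ih].
  by under eq_fun do rewrite big_nil; exact: bmf_cst.
under eq_fun do rewrite big_cons; case: (p i) => //.
exact: bmfD.
Qed.

Lemma bmf_integrable (mu : {measure set T -> \bar R}) (D : set T) f :
  measurable D -> (mu setT < +oo)%E -> bmf f -> mu.-integrable D (EFin \o f).
Proof.
move=> mD mufin [mf [C hC]]; apply: measurable_bounded_integrable => //.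
- by apply: le_lt_trans mufin; rewrite le_measure// ?inE.
- exact: measurable_funTS.
- exists C; split; first exact: num_real.
  by move=> B CB x _ /=; rewrite (le_trans (hC x))// ltW.
Qed.

Lemma bmf_integrable_prob (P : probability T R) f :
  bmf f -> P.-integrable setT (EFin \o f).
Proof.
move=> bf; apply: bmf_integrable => //.
have h : (P setT < +oo)%E by rewrite probability_setT ltry.
exact: h.
Qed.

Lemma Rintegral_prob_cst (P : probability T R) c : Rintegral P setT (fun=> c) = c.
Proof.
rewrite Rintegral_cst//; have /(congr1 fine) /= h := probability_setT P.
by rewrite -[RHS]mulr1 -h.
Qed.

Lemma bmf_le_Rintegral (P : probability T R) f C :
  bmf f -> (forall x, f x <= C) -> Rintegral P setT f <= C.
Proof.
move=> bf hC.
rewrite (_ : C = Rintegral P setT (fun=> C)); last first.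
  by rewrite Rintegral_prob_cst.
apply: le_Rintegral => //; first exact: bmf_integrable_prob.
by apply: bmf_integrable_prob; exact: bmf_cst.
Qed.

Lemma bmf_norm_Rintegral (P : probability T R) f C :
  bmf f -> (forall x, `|f x| <= C) -> `|Rintegral P setT f| <= C.
Proof.
move=> bf hC; rewrite (le_trans (le_normr_Rintegral _ _))//.
  exact: bmf_integrable_prob.
apply: bmf_le_Rintegral => //; case: bf => mf [D hD]; split.
  exact: measurableT_comp.
by exists D => x; rewrite normr_id.
Qed.

(* A list [:: (c_1, P_1); ...; (c_m, P_m)] stands for the signed measure
   c_1 P_1 + ... + c_m P_m. *)
Definition lint s f : R := \sum_(p <- s) p.1 * Rintegral p.2 setT f.

Definition scale (a : R) s := [seq (a * p.1, p.2) | p <- s].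

Lemma lint_cat s t f : lint (s ++ t) f = lint s f + lint t f.
Proof. by rewrite /lint big_cat. Qed.

Lemma lint_cons p s f : lint (p :: s) f = p.1 * Rintegral p.2 setT f + lint s f.
Proof. by rewrite /lint big_cons. Qed.

Lemma lint_nil f : lint [::] f = 0.
Proof. exact: big_nil. Qed.

Lemma lint1 (P : probability T R) f : lint [:: (1, P)] f = Rintegral P setT f.
Proof. by rewrite lint_cons lint_nil addr0 mul1r. Qed.

Lemma lint_scale a s f : lint (scale a s) f = a * lint s f.
Proof.
by rewrite /lint big_map mulr_sumr; apply: eq_bigr => p _; rewrite mulrA.
Qed.

Lemma lintD s f g : bmf f -> bmf g ->
  lint s (fun x => f x + g x) = lint s f + lint s g.
Proof.
move=> bf bg; rewrite /lint -big_split; apply: eq_bigr => p _ /=.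
by rewrite RintegralD//; [rewrite mulrDr | exact: bmf_integrable_prob | exact: bmf_integrable_prob].
Qed.

Lemma lintZ s c f : bmf f -> lint s (fun x => c * f x) = c * lint s f.
Proof.
move=> bf; rewrite /lint mulr_sumr; apply: eq_bigr => p _ /=.
by rewrite RintegralZl//; [rewrite mulrCA | exact: bmf_integrable_prob].
Qed.

Lemma lint_cst s c : lint s (fun=> c) = c * \sum_(p <- s) p.1.
Proof.
rewrite /lint mulr_sumr; apply: eq_bigr => p _.
by rewrite Rintegral_prob_cst mulrC.
Qed.

Lemma eq_lint s f g : f =1 g -> lint s f = lint s g.
Proof. by move=> fg; apply: eq_bigr => p _; congr (_ * _); apply: eq_Rintegral => x _. Qed.

Lemma lint_sum s (I : Type) (r : seq I) (p : pred I) (F : I -> T -> R) :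
  (forall i, bmf (F i)) ->
  lint s (fun x => \sum_(i <- r | p i) F i x) = \sum_(i <- r | p i) lint s (F i).
Proof.
move=> hF; elim: r => [|i r ih].
  rewrite big_nil; under eq_lint do rewrite big_nil.
  by rewrite lint_cst mul0r.
rewrite big_cons; under eq_lint do rewrite big_cons.
case: (p i) => //; rewrite lintD ?ih//; exact: bmf_sum.
Qed.

(** Adding [|C|] to a function bounded by [C] makes it nonnegative, and the constant can be
    subtracted again because the test function 1 shows that [mu] is finite. Sums and multiples of
    measures thus need checking on nonnegative integrands only. *)
Lemma ge0_lint_represents (mu : {measure set T -> \bar R}) s :
  (forall f, bmf f -> (forall x, 0 <= f x) ->
     (\int[mu]_x (f x)%:E = (lint s f)%:E)%E) ->
  forall f, bmf f -> (\int[mu]_x (f x)%:E = (lint s f)%:E)%E.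
Proof.
move=> H f bf; have [mf [C hC]] := bf.
have mufin : (mu setT < +oo)%E.
  have := H (fun=> 1) (bmf_cst 1) (fun=> ler01).
  by rewrite integral_cst// mul1e => ->; exact: ltry.
have bC : bmf (fun _ : T => `|C|) by exact: bmf_cst.
have bfC : bmf (fun x => f x + `|C|) by exact: bmfD.
transitivity (\int[mu]_x ((f x + `|C|)%:E - `|C|%:E))%E.
  by apply: eq_integral => x _; rewrite -EFinB addrK.
rewrite integralB//; last 2 first.
- exact: (bmf_integrable measurableT mufin bfC).
- exact: (bmf_integrable measurableT mufin bC).
have fC_ge0 x : 0 <= f x + `|C|.
  by have := hC x; have := ler_norm C; have := ler_norm (- f x); rewrite normrN; lra.
rewrite (H _ bfC fC_ge0) (H _ bC (fun=> normr_ge0 C)) lintD//.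
by rewrite -EFinB addrK.
Qed.

End BoundedMeasurable.

Lemma bmf_comp {R : realType} {d d'} {T : measurableType d} {U : measurableType d'}
  (f : U -> R) (h : T -> U) : measurable_fun setT h -> bmf f -> bmf (f \o h).
Proof.
move=> mh [mf [C hC]]; split; first exact: measurableT_comp.
by exists C => x /=.
Qed.

(** * Positivity of the kernel form *)

Section KernelForm.
Context {R : realType} (k : R -> R -> R).
Hypotheses (k_meas : kernel_measurable k) (k_bd : kernel_bounded_by_1 k).
Local Notation prob := (probability R R).
Implicit Types (s t : seq (R * prob)) (P Q : prob) (x y c a : R).

Lemma bmf_kernel2 : bmf (fun p : R * R => k p.1 p.2).
Proof. by split; [exact: k_meas | exists 1 => p; exact: k_bd]. Qed.

Lemma bmf_kernel x : bmf (k x).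
Proof.
exact: (bmf_comp (measurable_pair1 x) bmf_kernel2).
Qed.

Lemma bmf_kernel_diag : bmf (fun x => k x x).
Proof.
have m : measurable_fun setT (fun x : R => (x, x)) by exact: measurable_fun_pair.
exact: (bmf_comp m bmf_kernel2).
Qed.

Lemma integrable_kernel2 P Q :
  (P \x Q)%E.-integrable setT (fun p : R * R => (k p.1 p.2)%:E).
Proof. exact: (bmf_integrable_prob (P \x Q)%E bmf_kernel2). Qed.

Lemma Rintegral_kernelE P x :
  (\int[P]_y (k x y)%:E = (Rintegral P setT (k x))%:E)%E.
Proof.
rewrite /Rintegral fineK//; apply: integrable_fin_num => //.
exact: bmf_integrable_prob (bmf_kernel x).
Qed.

Lemma bmf_Rintegral_kernel P : bmf (fun x => Rintegral P setT (k x)).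
Proof.
split; last first.
  by exists 1 => x; apply: bmf_norm_Rintegral; [exact: bmf_kernel | exact: k_bd].
apply/measurable_EFinP.
(* The function is an inner integral of [k] over a product space, so its measurability is part of
   Fubini's theorem. *)
rewrite (_ : _ \o _ = fubini_F P (fun p : R * R => (k p.1 p.2)%:E)); last first.
  by apply/funext => x /=; rewrite -Rintegral_kernelE.
exact: measurable_fubini_F (integrable_kernel2 P P).
Qed.

Lemma bmf_lint_kernel s : bmf (fun x => lint s (k x)).
Proof.
rewrite /lint; apply: bmf_sum => p; apply: bmfZ; exact: bmf_Rintegral_kernel.
Qed.

(* <Phi(s), Phi(t)>_H *)
Definition ipk s t := lint s (fun x => lint t (k x)).

Lemma ipk_catl s1 s2 t : ipk (s1 ++ s2) t = ipk s1 t + ipk s2 t.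
Proof. exact: lint_cat. Qed.

Lemma ipk_scalel a s t : ipk (scale a s) t = a * ipk s t.
Proof. exact: lint_scale. Qed.

Lemma ipk_catr s t1 t2 : ipk s (t1 ++ t2) = ipk s t1 + ipk s t2.
Proof.
rewrite /ipk -lintD; [|exact: bmf_lint_kernel|exact: bmf_lint_kernel].
by apply: eq_lint => x; exact: lint_cat.
Qed.

Lemma ipk_scaler a s t : ipk s (scale a t) = a * ipk s t.
Proof.
rewrite /ipk -lintZ; last exact: bmf_lint_kernel.
by apply: eq_lint => x; exact: lint_scale.
Qed.

Lemma ipk_consl p s t : ipk (p :: s) t = p.1 * ipk [:: (1, p.2)] t + ipk s t.
Proof. by rewrite /ipk lint_cons lint1. Qed.

Lemma ipk_consr p s t : ipk s (p :: t) = p.1 * ipk s [:: (1, p.2)] + ipk s t.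
Proof.
rewrite -cat1s ipk_catr -ipk_scaler; congr (_ + _).
by rewrite /scale /= mulr1 -surjective_pairing.
Qed.

Lemma ipk_nill t : ipk [::] t = 0.
Proof. by rewrite /ipk /lint big_nil. Qed.

Lemma ipk_nilr s : ipk s [::] = 0.
Proof.
rewrite /ipk -[RHS](mul0r (\sum_(p <- s) p.1)) -lint_cst; apply: eq_lint => x; exact: lint_nil.
Qed.

Hypothesis k_pd : pos_def_kernel k.

Lemma ipk1C P Q : ipk [:: (1, P)] [:: (1, Q)] = ipk [:: (1, Q)] [:: (1, P)].
Proof.
have e P1 P2 : ipk [:: (1, P1)] [:: (1, P2)] =
    fine (\int[P1]_x \int[P2]_y (k x y)%:E)%E.
  rewrite /ipk lint1 /Rintegral; congr fine.
  by apply: eq_integral => x _; rewrite lint1 -Rintegral_kernelE.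
rewrite !e (Fubini (integrable_kernel2 P Q)); congr fine.
by apply: eq_integral => x _; apply: eq_integral => y _ /=; rewrite (k_pd.1 x).
Qed.

Lemma ipkC s t : ipk s t = ipk t s.
Proof.
elim: s => [|p s ih]; first by rewrite ipk_nill ipk_nilr.
rewrite ipk_consl ipk_consr ih; congr (_ * _ + _).
elim: t {ih} => [|q t ih]; first by rewrite ipk_nill ipk_nilr.
by rewrite ipk_consl ipk_consr ih ipk1C.
Qed.

Lemma ipk_cons p s : ipk (p :: s) (p :: s) =
  p.1 ^+ 2 * ipk [:: (1, p.2)] [:: (1, p.2)] + 2 * p.1 * ipk [:: (1, p.2)] s + ipk s s.
Proof.
rewrite ipk_consl (ipk_consr p [:: _] s) (ipk_consr p s s) (ipkC s [:: _]); ring.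
Qed.

Definition diracs (D : seq (R * R)) : seq (R * prob) :=
  [seq (p.1, (\d_(p.2) : prob)) | p <- D].

Lemma Rintegral_dirac x f : measurable_fun setT f -> Rintegral (\d_x : prob) setT f = f x.
Proof.
move=> mf; rewrite /Rintegral integral_dirac//; last exact/measurable_EFinP.
by rewrite diracT mul1e.
Qed.

Lemma lint_diracs D f : measurable_fun setT f ->
  lint (diracs D) f = \sum_(p <- D) p.1 * f p.2.
Proof.
by move=> mf; rewrite /lint big_map; apply: eq_bigr => p _ /=; rewrite Rintegral_dirac.
Qed.

Lemma ipk_diracs D E : ipk (diracs D) (diracs E) =
  \sum_(p <- D) \sum_(q <- E) p.1 * q.1 * k p.2 q.2.
Proof.
rewrite /ipk lint_diracs; last exact: (bmf_lint_kernel _).1.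
apply: eq_bigr => p _; rewrite lint_diracs; last exact: (bmf_kernel _).1.
by rewrite mulr_sumr; apply: eq_bigr => q _; rewrite mulrA.
Qed.

(** On atoms the form is the double sum of [pos_def_kernel]; positivity at general lists is derived
    from this case. *)
Lemma ipk_diracs_ge0 D : 0 <= ipk (diracs D) (diracs D).
Proof.
have := k_pd.2 (size D) (fun i => (nth (0, 0) D i).1) (fun i => (nth (0, 0) D i).2).
rewrite ipk_diracs (big_nth (0, 0)) big_mkord => h.
under eq_bigr do rewrite (big_nth (0, 0)) big_mkord.
exact: h.
Qed.

Lemma ipk_dirac x s : ipk [:: (1, (\d_x : prob))] s = lint s (k x).
Proof.
by rewrite /ipk lint1 Rintegral_dirac//; exact: (bmf_lint_kernel s).1.
Qed.

Lemma ipk1 P s : ipk [:: (1, P)] s = Rintegral P setT (fun x => lint s (k x)).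
Proof. by rewrite /ipk lint1. Qed.

(* Replacing an atom c \d_x by c P costs at most c^2 in the quadratic form, as is seen
   by averaging over x ~ P.  With m atoms of weight c / m the total cost is c^2 / m. *)
Lemma ipk_ge0_approx P L c (m : nat) :
  (forall D, 0 <= ipk (diracs D ++ L) (diracs D ++ L)) ->
  forall D, 0 <= ipk (diracs D ++ (m%:R * c, P) :: L) (diracs D ++ (m%:R * c, P) :: L)
    + m%:R * (c ^+ 2 * (Rintegral P setT (fun x => k x x) - ipk [:: (1, P)] [:: (1, P)])).
Proof.
move=> hL; elim: m => [|m ih] D.
  (* For [m = 0] the entry at [P] has weight zero and drops out of both arguments of the form. *)
  rewrite !mul0r addr0; set v := _ ++ _ :: _.
  have -> : ipk v v = ipk (diracs D ++ L) (diracs D ++ L); last exact: hL.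
  have e s t : ipk (s ++ (0, P) :: L) t = ipk (s ++ L) t.
    by rewrite !ipk_catl ipk_consl mul0r add0r.
  by rewrite e ipkC e.
set v := diracs D ++ (m%:R * c, P) :: L; set K := Rintegral _ _ _; set b := ipk [:: _] [:: _].
have [z zE] : exists z, z = ipk v v + m%:R * (c ^+ 2 * (K - b)) by eexists.
(* [g x] is what the induction hypothesis shows to be nonnegative once the atom [(c, x)] joins [D].
   Its integral over [x] under [P] is the expression claimed for [m.+1]. *)
pose g x := c ^+ 2 * k x x + 2 * c * lint v (k x) + z.
have g_ge0 x : 0 <= g x.
  have := ih ((c, x) :: D); rewrite /= -/v ipk_cons /= !ipk_dirac.
  by rewrite lint1 Rintegral_dirac; [rewrite /g zE addrA|exact: (bmf_kernel _).1].
have : 0 <= lint [:: (1, P)] g by rewrite lint1; apply: Rintegral_ge0 => x _; exact: g_ge0.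
have bK := bmf_kernel_diag; have bv := bmf_lint_kernel v.
rewrite /g lintD; [|exact: (bmfD (bmfZ _ bK) (bmfZ _ bv))|exact: bmf_cst].
rewrite lintD; [|exact: (bmfZ _ bK)|exact: (bmfZ _ bv)].
rewrite !lintZ// lint_cst big_seq1 /= mulr1 lint1 -/K.
rewrite -/(ipk [:: (1, P)] v).
set w := diracs D ++ (m.+1%:R * c, P) :: L.
have wE t : ipk w t = c * ipk [:: (1, P)] t + ipk v t.
  rewrite /w /v !ipk_catl (ipk_consl (m%:R * c, P)) (ipk_consl (m.+1%:R * c, P)) /= -natr1; ring.
rewrite wE !(ipkC _ w) !wE -/b (ipkC v) -natr1 zE => h.
apply: le_trans h _; rewrite le_eqVlt; apply/orP; left; apply/eqP; ring.
Qed.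

(** Splitting the weight [c] into [m] copies of [c / m] leaves an error [B / m], which tends to 0 as
    [m] grows. *)
Lemma ipk_ge0_add P L c :
  (forall D, 0 <= ipk (diracs D ++ L) (diracs D ++ L)) ->
  forall D, 0 <= ipk (diracs D ++ (c, P) :: L) (diracs D ++ (c, P) :: L).
Proof.
move=> hL D; set q := ipk _ _.
pose B := c ^+ 2 * (Rintegral P setT (fun x => k x x) - ipk [:: (1, P)] [:: (1, P)]).
have h (m : nat) : (0 < m)%N -> 0 <= q + B / m%:R.
  move=> m0; have m0' : m%:R != 0 :> R by rewrite pnatr_eq0 -lt0n.
  have := ipk_ge0_approx P (c / m%:R) m hL D.
  rewrite mulrCA divff// mulr1 -/q.
  suff -> : m%:R * ((c / m%:R) ^+ 2 *
      (Rintegral P setT (fun x => k x x) - ipk [:: (1, P)] [:: (1, P)])) = B / m%:R by [].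
  rewrite /B; field; exact: m0'.
rewrite leNgt; apply/negP => q0.
(* For this [m] the error [B / m] lies below [- q], which contradicts [h]. *)
pose m := (Num.trunc (`|B| / - q)).+1.
have := h m isT.
have m0 : 0 < m%:R :> R by rewrite ltr0n.
have : `|B| / - q < m%:R by rewrite /m; exact: truncnS_gt.
rewrite ltr_pdivrMr ?oppr_gt0// => h1.
have : B / m%:R < - q by rewrite ltr_pdivrMr// mulrC (le_lt_trans (ler_norm _)).
lra.
Qed.

(** Each entry of the list is obtained by consuming atoms, so the induction carries an arbitrary
    supply [D] of them; the claim is the case of empty [D]. *)
Lemma ipk_ge0 s : 0 <= ipk s s.
Proof.
suff h D : 0 <= ipk (diracs D ++ s) (diracs D ++ s) by exact: (h [::]).
elim: s D => [|[c P] s ih] D; first by rewrite cats0; exact: ipk_diracs_ge0.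
exact: ipk_ge0_add.
Qed.

End KernelForm.

(** * The seminorm of the kernel form and its relation to the MMD *)

Section KernelNorm.
Context {R : realType} (k : R -> R -> R).
Hypotheses (k_meas : kernel_measurable k) (k_pd : pos_def_kernel k)
  (k_bd : kernel_bounded_by_1 k).
Local Notation prob := (probability R R).
Local Notation ipk := (ipk k).
Implicit Types (s t u : seq (R * prob)) (P Q : prob) (x y c a : R).

Definition nrm s := Num.sqrt (ipk s s).

Lemma nrm_ge0 s : 0 <= nrm s. Proof. exact: sqrtr_ge0. Qed.

Lemma sqr_nrm s : nrm s ^+ 2 = ipk s s.
Proof. by rewrite sqr_sqrtr// ipk_ge0. Qed.

Lemma ipk_scale_cat a s t :
  ipk (s ++ scale a t) (s ++ scale a t) = ipk s s + 2 * a * ipk s t + a ^+ 2 * ipk t t.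
Proof.
rewrite !(ipk_catl, ipk_catr k_meas k_bd) !(ipk_scalel, ipk_scaler k_meas k_bd).
rewrite (ipkC k_meas k_bd k_pd t s); ring.
Qed.

(** The form at [s + a t] is a nonnegative quadratic polynomial in [a], evaluated at its minimiser.
    The form may vanish at a nonzero [t], hence the two cases. *)
Lemma ipk_cauchy_schwarz s t : ipk s t ^+ 2 <= ipk s s * ipk t t.
Proof.
have h a : 0 <= ipk s s + 2 * a * ipk s t + a ^+ 2 * ipk t t.
  by rewrite -ipk_scale_cat ipk_ge0.
have [t0|t0] := eqVneq (ipk t t) 0.
  have [->|st0] := eqVneq (ipk s t) 0; first by rewrite expr0n/= mulr_ge0// ipk_ge0.
  (* Without a quadratic term, this [a] would give the polynomial the value -1. *)
  have := h (- (ipk s s + 1) / (2 * ipk s t)); rewrite t0 mulr0 addr0.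
  rewrite (_ : _ + _ = - 1); first by rewrite oppr_ge0 ler10.
  by field.
have tp : 0 < ipk t t by rewrite lt_def t0 ipk_ge0.
have := h (- (ipk s t / ipk t t)).
rewrite (_ : _ + _ = ipk s s - ipk s t ^+ 2 / ipk t t); last by field.
by rewrite subr_ge0 ler_pdivrMr.
Qed.

Lemma nrm_cat s t : nrm (s ++ t) <= nrm s + nrm t.
Proof.
have st : ipk s t <= nrm s * nrm t.
  rewrite /nrm -sqrtrM ?ipk_ge0//; apply: le_trans (ler_norm _) _.
  by rewrite -sqrtr_sqr ler_wsqrtr// ipk_cauchy_schwarz.
rewrite -(@ler_pXn2r _ 2%N) ?nnegrE ?addr_ge0 ?nrm_ge0//.
rewrite sqr_nrm sqrrD !sqr_nrm !(ipk_catl, ipk_catr k_meas k_bd).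
rewrite (ipkC k_meas k_bd k_pd t s); lra.
Qed.

Lemma nrm_scale a s : nrm (scale a s) = `|a| * nrm s.
Proof.
rewrite /nrm ipk_scalel ipk_scaler// mulrA -expr2 sqrtrM ?sqr_ge0//.
by rewrite sqrtr_sqr.
Qed.

(** Many lists stand for the same signed measure, and the norm sees only the functional on bounded
    measurable functions. This is what allows common terms of two lists to cancel. *)
Lemma eq_nrm s t : (forall f, bmf f -> lint s f = lint t f) -> nrm s = nrm t.
Proof.
move=> e; congr Num.sqrt; transitivity (lint t (fun x => lint s (k x))).
  by apply: e; exact: bmf_lint_kernel.
by apply: eq_lint => x; apply: e; exact: bmf_kernel.
Qed.

(** As [k] is bounded by 1, each of the two integrations against [s] multiplies the bound by the l^1
    norm of the weights. *)
Lemma nrm_le s : nrm s <= \sum_(p <- s) `|p.1|.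
Proof.
have lint_le f C : 0 <= C -> bmf f -> (forall x, `|f x| <= C) ->
    `|lint s f| <= C * \sum_(p <- s) `|p.1|.
  move=> C0 bf hC; rewrite mulr_sumr (le_trans (ler_norm_sum _ _ _))//.
  apply: ler_sum => p _; rewrite normrM mulrC ler_wpM2r//.
  exact: bmf_norm_Rintegral.
have S0 : 0 <= \sum_(p <- s) `|p.1| by exact: sumr_ge0.
rewrite /nrm -[leRHS]ger0_norm// -sqrtr_sqr ler_wsqrtr//.
apply: le_trans (ler_norm _) _; rewrite expr2; apply: (lint_le) => //.
  exact: bmf_lint_kernel.
move=> x; rewrite -[leRHS]mul1r; apply: (lint_le) => //; exact: bmf_kernel.
Qed.

Definition dist s t := nrm (s ++ scale (- 1) t).

Lemma lint_sub s t f : lint (s ++ scale (- 1) t) f = lint s f - lint t f.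
Proof. by rewrite lint_cat lint_scale mulN1r. Qed.

Lemma dist_sym s t : dist s t = dist t s.
Proof.
have := nrm_scale (-1) (t ++ scale (-1) s); rewrite normrN1 mul1r /dist => <-.
apply: eq_nrm => f _; rewrite lint_scale !lint_sub; ring.
Qed.

Lemma dist_triangle t s u : dist s u <= dist s t + dist t u.
Proof.
apply: le_trans (nrm_cat _ _); rewrite /dist.
rewrite (eq_nrm (t := (s ++ scale (- 1) t) ++ t ++ scale (- 1) u))// => f _.
rewrite !(lint_cat, lint_scale); ring.
Qed.

(** An empirical measure may have mass 0 and so need not be a probability. This relation lets a list
    of weighted Dirac masses take its place inside [kint]. *)
Definition represents (mu : {measure set R -> \bar R}) s :=
  forall f : R -> R, bmf f -> (\int[mu]_x (f x)%:E = (lint s f)%:E)%E.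

Lemma represents_prob P : represents P [:: (1, P)].
Proof.
move=> f bf; rewrite lint1 /Rintegral fineK//.
by apply: integrable_fin_num => //; exact: bmf_integrable_prob.
Qed.

Lemma kint_represents (mu nu : {measure set R -> \bar R}) s t :
  represents mu s -> represents nu t -> kint k mu nu = ipk s t.
Proof.
move=> hs ht; rewrite /kint.
transitivity (fine (\int[mu]_x (lint t (k x))%:E)%E).
  by congr fine; apply: eq_integral => x _; apply: ht; exact: bmf_kernel.
by rewrite hs//; exact: bmf_lint_kernel.
Qed.

Lemma MMD_represents (mu nu : {measure set R -> \bar R}) s t :
  represents mu s -> represents nu t -> MMD k mu nu = dist s t.
Proof.
move=> hs ht; rewrite /MMD /dist /nrm; congr Num.sqrt.
rewrite (kint_represents hs hs) (kint_represents hs ht) (kint_represents ht hs).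
rewrite (kint_represents ht ht) ipk_scale_cat (ipkC k_meas k_bd k_pd t); ring.
Qed.

End KernelNorm.

(** * Empirical measures as weighted atoms *)

Section Empirical.
Context {R : realType} (n : nat).
Implicit Types (x c : 'I_n -> R) (m : 'I_n -> bool).

Definition unmasked m : nat := #|[pred i | ~~ m i]|.

Lemma card_unmasked m : #|[set i | ~~ m i]%classic| = unmasked m.
Proof. by apply: eq_card => i; apply/idP/idP => [/set_mem|/mem_set]. Qed.

Definition atoms x c : seq (R * probability R R) :=
  diracs [seq (c i, x i) | i <- index_enum 'I_n].

Lemma lint_atoms x c f : measurable_fun setT f ->
  lint (atoms x c) f = \sum_(i < n) c i * f (x i).
Proof.
by move=> mf; rewrite /atoms lint_diracs// big_map.
Qed.

Lemma sum_atoms x c : \sum_(p <- atoms x c) `|p.1| = \sum_(i < n) `|c i|.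
Proof. by rewrite /atoms /diracs !big_map. Qed.

(** If every index is masked, all numerators vanish and so do the weights, in agreement with the
    zero measure given by [emp]. *)
Definition weight m (i : 'I_n) : R := (~~ m i)%:R / (maxn 1 (unmasked m))%:R.

Lemma represents_emp x m : represents (emp x m) (atoms x (weight m)).
Proof.
apply: ge0_lint_represents => f [mf _] f0.
have mf' : measurable_fun setT (EFin \o f) by exact/measurable_EFinP.
have f0' y : [set: R] y -> (0 <= (EFin \o f) y)%E by rewrite lee_fin f0.
rewrite /emp ge0_integral_mscale// ge0_integral_measure_sum// lint_atoms//=.
rewrite card_unmasked.
set w := (_^-1 : R).
transitivity (w%:E * \sum_(i < n) ((~~ m i)%:R * f (x i))%:E)%E.
  congr (_ * _)%E; apply: eq_bigr => i _; rewrite valK.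
  case: (m i); first by rewrite integral_measure_zero mul0r.
  by rewrite integral_dirac// diracT mul1e mul1r.
rewrite sumEFin -EFinM; congr EFin.
rewrite mulr_sumr; apply: eq_bigr => i _; by rewrite /weight -/w mulrCA mulrA.
Qed.

End Empirical.

(** * Deterministic bounds and the binomial sum *)

Section Contamination.
Context {R : realType} (k : R -> R -> R).
Hypotheses (k_meas : kernel_measurable k) (k_pd : pos_def_kernel k)
  (k_bd : kernel_bounded_by_1 k).

Lemma dist_atoms (n : nat) (x c c' : 'I_n -> R) :
  dist k (atoms x c) (atoms x c') <= \sum_(i < n) `|c i - c' i|.
Proof.
rewrite -(sum_atoms x (fun i => c i - c' i)).
rewrite /dist (eq_nrm k_meas k_bd (t := atoms x (fun i => c i - c' i))).
  exact: nrm_le.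
move=> f [mf _].
rewrite lint_sub !lint_atoms// -sumrB.
by apply: eq_bigr => i _; rewrite mulrBl.
Qed.

(** The difference [mu - P] equals [eps (Q - P)], whose weights have absolute sum [2 * eps]. *)
Lemma dist_mixture (P Q mu : probability R R) (eps : R) : 0 <= eps <= 1 ->
  (forall A, measurable A -> mu A = ((1 - eps)%:E * P A + eps%:E * Q A)%E) ->
  dist k [:: (1, mu)] [:: (1, P)] <= 2 * eps.
Proof.
move=> /andP[e0 e1] muE.
have e1' : 0 <= 1 - eps by rewrite subr_ge0.
have rep : represents mu [:: (1 - eps, P); (eps, Q)].
  apply: ge0_lint_represents => f bf f0.
  have mf : measurable_fun setT (EFin \o f) by apply/measurable_EFinP; case: bf.
  rewrite (eq_measure_integral (measure_add (mscale (NngNum e1') P) (mscale (NngNum e0) Q)));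
    last first.
    move=> A mA _.
    by rewrite [RHS](measure_addE (mscale (NngNum e1') P) (mscale (NngNum e0) Q)); exact: muE.
  rewrite ge0_integral_measure_add//; [|by move=> y _; rewrite lee_fin].
  rewrite !ge0_integral_mscale//; try by move=> y _; rewrite lee_fin.
  rewrite !(represents_prob _ bf) -!EFinM -EFinD; congr EFin.
  by rewrite !lint_cons !lint_nil !addr0 !mul1r.
have e f : bmf f -> lint [:: (1, mu)] f = lint [:: (1 - eps, P); (eps, Q)] f.
  by move=> bf; apply: EFin_inj; rewrite -(represents_prob mu bf) rep.
rewrite /dist (eq_nrm k_meas k_bd (t := [:: (eps, Q); (- eps, P)])).
  apply: le_trans (nrm_le k_meas k_bd _) _.
  by rewrite !big_cons big_nil /= addr0 normrN ger0_norm// mulr2n mulrDl mul1r.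
move=> f bf; rewrite lint_sub e// !lint_cons !lint_nil /=; ring.
Qed.

End Contamination.

Section Weights.
Context {R : realType} (n : nat).
Implicit Types m : 'I_n -> bool.

Lemma unmasked_sum m : (unmasked m)%:R = \sum_(i < n) (~~ m i)%:R :> R.
Proof.
rewrite /unmasked -sum1_card natr_sum big_mkcond /=.
by apply: eq_bigr => i _; rewrite inE; case: (m i).
Qed.

(** Let [N > 0] and [N'] be the two unmasked counts and [D] the number of flips. The flips cost at
    most [D / N'], and the change of denominator costs [|N' - N| / N' <= D / N']. Since
    [D <= N delta] and [N' >= N (1 - delta)], each part is at most [delta / (1 - delta)]. *)
Lemma weight_perturbation m m' (delta : R) : 0 <= delta < 1 ->
  \sum_(i < n) (m' i != m i)%:R <= (unmasked m)%:R * delta ->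
  \sum_(i < n) `|weight m' i - weight m i| <= 2 * (delta / (1 - delta)) :> R.
Proof.
move=> /andP[d0 d1]; set D := \sum_(i < n) _ => hD.
have d1' : 0 < 1 - delta by rewrite subr_gt0.
(* With nothing unmasked in [m] the budget for flips is zero, so the two masks coincide. *)
have [N0|N0] := posnP (unmasked m).
  have Dz : D = 0.
    by apply/eqP; rewrite eq_le sumr_ge0// andbT (le_trans hD)// N0 mul0r.
  have mm i : m' i = m i.
    have := psumr_eq0P (fun i _ => ler0n R (m' i != m i)) Dz (i := i) isT.
    by move/eqP; rewrite pnatr_eq0 eqb0 negbK => /eqP.
  rewrite big1; first by rewrite mulr_ge0// divr_ge0// ltW.
  move=> i _.
  rewrite (_ : m' = m) ?subrr ?normr0//; exact/funext.
have hN : `|(unmasked m')%:R - (unmasked m)%:R| <= D :> R.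
  rewrite !unmasked_sum -sumrB (le_trans (ler_norm_sum _ _ _))// ler_sum// => i _.
  by case: (m i); case: (m' i) => /=; rewrite ?subrr ?subr0 ?sub0r ?normrN ?normr0 ?normr1.
set N := (unmasked m)%:R in hD hN; set N' := (unmasked m')%:R in hN.
have Np : 0 < N :> R by rewrite ltr0n.
have N'D : N * (1 - delta) <= N' by move: hN; rewrite ler_distl => /andP[]; lra.
have N'p : 0 < N' by rewrite (lt_le_trans _ N'D)// mulr_gt0.
have N'0 : (0 < unmasked m')%N by rewrite -(ltr0n R).
have wE m0 i : (0 < unmasked m0)%N -> weight m0 i = (~~ m0 i)%:R / (unmasked m0)%:R :> R.
  by move=> h; rewrite /weight (maxn_idPr h).
(* The first term pays for a changed label, the second for the changed denominator at an index
   unmasked in [m]. *)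
apply: (@le_trans _ _ (\sum_(i < n) ((m' i != m i)%:R / N' + (~~ m i)%:R * `|N^-1 - N'^-1|))).
  apply: ler_sum => i _; rewrite !wE// -/N -/N'.
  have := ler_norm (N'^-1 - N^-1); have := ler_norm (N^-1 - N'^-1).
  have : 0 < N^-1 by rewrite invr_gt0.
  have : 0 < N'^-1 by rewrite invr_gt0.
  case: (m i); case: (m' i) => /=;
    rewrite ?mul0r ?mul1r ?subrr ?subr0 ?sub0r ?add0r ?addr0 ?normrN ?normr0//.
  - by move=> h _ _ _; rewrite ger0_norm// ltW.
  - by move=> _ h h2 _; rewrite (gtr0_norm h); lra.
  - by rewrite distrC.
rewrite big_split /= -!mulr_suml -/D -(unmasked_sum m) -/N.
have -> : N * `|N^-1 - N'^-1| = `|N' - N| / N'.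
  rewrite -[X in X * _](gtr0_norm Np) -normrM -[X in _ / X](gtr0_norm N'p) -normf_div.
  by congr `|_|; field; rewrite !gt_eqF.
have : `|N' - N| / N' <= D / N' by rewrite ler_wpM2r// invr_ge0 ltW.
suff : D / N' <= delta / (1 - delta) by lra.
rewrite ler_pdivrMr// mulrAC ler_pdivlMr//.
have : D * (1 - delta) <= N * delta * (1 - delta) by rewrite ler_wpM2r// ltW.
have : delta * (N * (1 - delta)) <= delta * N' by rewrite ler_wpM2l.
lra.
Qed.

Lemma sum_over_card (g : nat -> R) :
  \sum_(S : {set 'I_n}) g #|S| = \sum_(s < n.+1) 'C(n, s)%:R * g s.
Proof.
rewrite (partition_big (fun S : {set 'I_n} => inord #|S| : 'I_n.+1) predT)//=.
apply: eq_bigr => s _.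
have cS (S : {set 'I_n}) : (#|S| < n.+1)%N by rewrite ltnS -[leqRHS]card_ord max_card.
rewrite (eq_bigl (fun S : {set 'I_n} => #|S| == s)); last first.
  by move=> S; rewrite -val_eqE /= inordK.
rewrite (eq_bigr (fun=> g s)); last by move=> S /eqP ->.
rewrite sumr_const mulr_natl; congr (_ *+ _).
have := card_draws 'I_n s; rewrite card_ord => <-.
by apply: eq_card => S; rewrite !inE.
Qed.

(** For a binomial count [B] one has [1 / max(1, B) <= 2 / (B + 1)], and the mean of [1 / (B + 1)]
    is at most [1 / ((n + 1) alpha)] by the binomial theorem with exponent [n + 1]. *)
Lemma binomial_inverse_moment (alpha : R) : (0 < n)%N -> 0 < alpha <= 1 ->
  \sum_(S : {set 'I_n}) alpha ^+ #|S| * (1 - alpha) ^+ (n - #|S|) / (maxn 1 #|S|)%:R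
  <= 2 / (n%:R * alpha).
Proof.
move=> n0 /andP[a0 a1].
rewrite (sum_over_card (fun s => alpha ^+ s * (1 - alpha) ^+ (n - s) / (maxn 1 s)%:R)).
have b0 : 0 <= 1 - alpha by rewrite subr_ge0.
have np : 0 < n%:R :> R by rewrite ltr0n.
have : \sum_(s < n.+1) 'C(n, s)%:R * (alpha ^+ s * (1 - alpha) ^+ (n - s)) / s.+1%:R
    <= (n.+1%:R * alpha)^-1.
  rewrite -[leRHS]mulr1 ler_pdivlMl; last by rewrite mulr_gt0// ltr0n.
  have e1 : (1 - alpha + alpha) ^+ n.+1 = 1 by rewrite subrK expr1n.
  (* The terms of index [s.+1] in this expansion match the sum on the left; the nonnegative term of
     index 0 is discarded. *)
  rewrite -[leRHS]e1 [leRHS]exprDn [leRHS]big_ord_recl /= mulr_sumr ler_wpDl//.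
    by rewrite mulrn_wge0// mulr_ge0// exprn_ge0// ltW.
  apply: ler_sum => s _; rewrite /bump /= add1n subSS.
  (* The absorption identity trades the denominator [s.+1] for a shift of both entries of the
     binomial coefficient. *)
  have h : n.+1%:R * 'C(n, s)%:R = s.+1%:R * 'C(n.+1, s.+1)%:R :> R.
    by rewrite -!natrM mul_bin_diag.
  rewrite -[X in _ <= X]mulr_natr exprS.
  rewrite le_eqVlt; apply/orP; left; apply/eqP.
  transitivity (n.+1%:R * 'C(n, s)%:R * alpha * (alpha ^+ s * (1 - alpha) ^+ (n - s)) / s.+1%:R).
    by ring.
  rewrite h; field; by rewrite nat1r pnatr_eq0.
move=> h.
have h2 : \sum_(s < n.+1) 'C(n, s)%:R * (alpha ^+ s * (1 - alpha) ^+ (n - s) / (maxn 1 s)%:R) <=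
   2 * \sum_(s < n.+1) 'C(n, s)%:R * (alpha ^+ s * (1 - alpha) ^+ (n - s)) / s.+1%:R.
  rewrite mulr_sumr; apply: ler_sum => s _.
  have hM : (maxn 1 s)%:R^-1 <= 2 / s.+1%:R :> R.
    rewrite ler_pdivlMr ?ltr0n// mulrC ler_pdivrMr ?ltr0n ?leq_max//.
    by rewrite -natrM ler_nat; lia.
  have p0 : 0 <= 'C(n, s)%:R * (alpha ^+ s * (1 - alpha) ^+ (n - s)).
    by rewrite !mulr_ge0// exprn_ge0// ltW.
  rewrite mulrA [leRHS]mulrCA; exact: ler_wpM2l.
have h3 : (n.+1%:R * alpha)^-1 <= (n%:R * alpha)^-1.
  rewrite lef_pV2 ?posrE ?mulr_gt0 ?ltr0n//.
  by rewrite ler_wpM2r ?ler_nat// ltW.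
apply: le_trans h2 _; rewrite ler_wpM2l//; exact: le_trans h h3.
Qed.

End Weights.

(** * The sampling error *)

Lemma bmf_indicM {R : realType} {d} {T : measurableType d} (E : set T) (f : T -> R) :
  measurable E -> bmf f -> bmf (fun x => \1_E x * f x).
Proof.
move=> mE [mf [C hC]]; split; first by apply: measurable_funM => //; exact: measurable_indic.
exists C => x; rewrite normrM indicE; case: (x \in E); rewrite ?normr1 ?mul1r//.
by rewrite normr0 mul0r (le_trans (normr_ge0 (f x))).
Qed.

(** * Integrals over an event independent of a random variable *)

Section ConditionalLaw.
Context {R : realType} {d d' : measure_display} {Om : measurableType d}
  {T : measurableType d'}.
Variables (P : probability Om R) (U : {mfun Om >-> T}) (E : set Om).
Hypothesis mE : measurable E.

(** The hypothesis says that [P] restricted to [E] has image [p mu] under [U]; a change of variables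
    does the rest. *)
Lemma Rintegral_indic_indep (mu : probability T R) (p : R) : 0 <= p ->
  (forall A, measurable A -> P (E `&` U @^-1` A) = (p%:E * mu A)%E) ->
  forall h, bmf h -> Rintegral P setT (fun w => \1_E w * h (U w)) = p * Rintegral mu setT h.
Proof.
move=> p0 H h bh.
have mU : measurable_fun setT U by [].
pose PE : {measure set Om -> \bar R} := mrestr P mE.
have rep f : bmf f -> (\int[pushforward PE U]_x (f x)%:E = (lint [:: (p, mu)] f)%:E)%E.
  move: f; apply: ge0_lint_represents => f bf f0.
  have mf : measurable_fun setT (EFin \o f) by apply/measurable_EFinP; case: bf.
  rewrite (eq_measure_integral (mscale (NngNum p0) mu)); last first.
    by move=> A mA _; have := H A mA; rewrite setIC.
  rewrite ge0_integral_mscale//; last by move=> y _; rewrite lee_fin.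
  rewrite lint_cons lint_nil addr0 EFinM; congr (_ * _)%E.
  by rewrite /Rintegral fineK//; apply: integrable_fin_num => //; exact: bmf_integrable_prob.
have bhU : bmf (h \o U) by exact: bmf_comp.
have PEfin : (PE setT < +oo)%E.
  by rewrite /PE /= /mrestr setTI (le_lt_trans (probability_le1 _ mE))// ltry.
have iPE : PE.-integrable setT (EFin \o (h \o U)) by exact: bmf_integrable.
rewrite -(lint1 mu h); apply: EFin_inj.
have <- : (\int[pushforward PE U]_x (h x)%:E = (p * lint [:: (1, mu)] h)%:E)%E.
  by rewrite rep// lint1 lint_cons lint_nil addr0.
rewrite integral_pushforward//; last by apply/measurable_EFinP; case: bh.
rewrite preimage_setT (negligible_integral (N := ~` E)) //; first last.
- by rewrite /PE /= /mrestr setICl measure0.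
- exact: measurableC.
rewrite setTD setCK (eq_measure_integral P); last first.
  by move=> A mA AE; rewrite /PE /= /mrestr setIidl.
rewrite integral_mkcond /Rintegral fineK; last first.
  apply: integrable_fin_num => //; apply: bmf_integrable_prob; exact: bmf_indicM.
apply: eq_integral => w _; rewrite patchE indicE.
by case: (w \in E); rewrite ?mul1r ?mul0r.
Qed.

End ConditionalLaw.

(** * Mean square distance between the empirical measure and the law of the data *)

Section Sampling.
Context {R : realType} (k : R -> R -> R) {d : measure_display}
  {Om : measurableType d} (P : probability Om R) (n : nat)
  (X : 'I_n -> Om -> R) (M : 'I_n -> Om -> bool)
  (mu : probability R R) (alpha : R).
Hypotheses (k_meas : kernel_measurable k) (k_pd : pos_def_kernel k)
  (k_bd : kernel_bounded_by_1 k) (sample : MCAR_sample P X M mu alpha).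

(** Since the mask value [false] means observed, [S] is the set of observed indices. These events
    partition the space, and on each of them the random weights are constant. *)
Definition mask_event (S : {set 'I_n}) : set Om :=
  \bigcap_(i in [set: 'I_n]) (M i @^-1` [set i \notin S]).

Definition mask_prob (S : {set 'I_n}) : R :=
  alpha ^+ #|S| * (1 - alpha) ^+ (n - #|S|).

Let mX i : measurable_fun setT (X i). Proof. by case: sample. Qed.

Let mM i b : measurable (M i @^-1` [set b]). Proof. by case: sample. Qed.

Lemma measurable_mask_event S : measurable (mask_event S).
Proof. by apply: fin_bigcap_measurable => // i _; exact: mM. Qed.

Lemma mask_prob_marginal i b : P (M i @^-1` [set b]) = (if b then 1 - alpha else alpha)%:E.
Proof.
case: sample => _ _ _ _ lawM; case: b => //.
rewrite (_ : M i @^-1` _ = ~` (M i @^-1` [set false])).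
  by rewrite probability_setC// lawM -EFinB.
by apply/seteqP; split => w /=; case: (M i w).
Qed.

Lemma alpha_bounds : (0 < n)%N -> 0 <= alpha <= 1.
Proof.
move=> n0; have h := mask_prob_marginal (Ordinal n0) false.
have a1 : (P (M (Ordinal n0) @^-1` [set false]) <= 1)%E by exact: probability_le1.
have a0 : (0 <= P (M (Ordinal n0) @^-1` [set false]))%E by exact: measure_ge0.
by move: a0 a1; rewrite h !lee_fin => -> ->.
Qed.

Lemma mask_prob_indep S (A : 'I_n -> set R) : (forall i, measurable (A i)) ->
  P (mask_event S `&` \bigcap_(i in [set: 'I_n]) (X i @^-1` A i)) =
  ((mask_prob S)%:E * \prod_(i < n) mu (A i))%E.
Proof.
move=> mA; case: (sample) => _ _ indep lawX _.
rewrite setIC -bigcapI (indep A (fun i => [set i \notin S]) mA) big_split /= muleC.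
congr (_ * _)%E; last by apply: eq_bigr => i _; exact: lawX.
rewrite (eq_bigr (fun i => (if i \in S then alpha else 1 - alpha)%:E)); last first.
  by move=> i _; rewrite mask_prob_marginal if_neg.
rewrite prodEFin; congr EFin; rewrite (bigID (mem S)) /= /mask_prob.
congr (_ * _).
  by rewrite -prodr_const; apply: eq_bigr => i ->.
rewrite (eq_bigr (fun=> 1 - alpha)); last by move=> i /negbTE ->.
have -> : (n - #|S| = #|[predC S]|)%N.
  by rewrite -[X in (X - _)%N]card_ord -(cardC (mem S)) addKn.
by rewrite prodr_const.
Qed.

Lemma mask_prob_indep1 S i (A : set R) : measurable A ->
  P (mask_event S `&` X i @^-1` A) = ((mask_prob S)%:E * mu A)%E.
Proof.
move=> mA; have := @mask_prob_indep S (fun l => if l == i then A else setT).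
rewrite (bigD1 i)//= eqxx big1 ?mule1; last first.
  by move=> j /negbTE ->; rewrite probability_setT.
move=> <-; last by move=> l; case: ifP.
congr (P (_ `&` _)); apply/seteqP; split => w /=.
  by move=> h l _ /=; case: eqP => // ->.
by move=> /(_ i I) /=; rewrite eqxx.
Qed.

Lemma mask_prob_indep2 S i j (A B : set R) : i != j -> measurable A -> measurable B ->
  P (mask_event S `&` (X i @^-1` A `&` X j @^-1` B)) = ((mask_prob S)%:E * (mu A * mu B))%E.
Proof.
move=> ij mA mB.
have := @mask_prob_indep S (fun l => if l == i then A else if l == j then B else setT).
have ji : j != i by rewrite eq_sym.
rewrite (bigD1 i)//= eqxx (bigD1 j ji)/= (negbTE ji) eqxx.
rewrite big1 ?mule1; last first.
  by move=> l /andP[/negbTE -> /negbTE ->]; rewrite probability_setT.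
move=> <-; last by move=> l; case: ifP => // _; case: ifP.
congr (P (_ `&` _)); apply/seteqP; split => w /=.
  by move=> [hA hB] l _ /=; case: eqP => [->//|_]; case: eqP => [->|].
move=> h; split; first by have := h i I; rewrite /= eqxx.
by have := h j I; rewrite /= (negbTE ji) eqxx.
Qed.

Lemma mask_prob_ge0 S : (0 < n)%N -> 0 <= mask_prob S.
Proof.
by move=> /alpha_bounds /andP[a0 a1]; rewrite mulr_ge0// exprn_ge0// subr_ge0.
Qed.

Lemma Rintegral_mask1 S i f : bmf f ->
  Rintegral P setT (fun w => \1_(mask_event S) w * f (X i w)) =
  mask_prob S * Rintegral mu setT f.
Proof.
move=> bf; have n0 : (0 < n)%N by exact: leq_ltn_trans (ltn_ord i).
pose Xi : {mfun Om >-> R} := MeasurableFun.Pack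
  (MeasurableFun.Class (isMeasurableFun.Build _ _ _ _ _ (mX i))).
apply: (Rintegral_indic_indep (P := P) (U := Xi)) => //.
- exact: measurable_mask_event.
- exact: mask_prob_ge0.
- by move=> A mA; exact: mask_prob_indep1.
Qed.

(** Independence is known on rectangles; uniqueness of the product measure extends it to all
    measurable sets of the plane. *)
Lemma Rintegral_mask2 S i j (h : R * R -> R) : i != j -> bmf h ->
  Rintegral P setT (fun w => \1_(mask_event S) w * h (X i w, X j w)) =
  mask_prob S * Rintegral (mu \x mu)%E setT h.
Proof.
move=> ij bh; have n0 : (0 < n)%N by exact: leq_ltn_trans (ltn_ord i).
have mE := measurable_mask_event S.
have p0 := mask_prob_ge0 S n0.
have mXX : measurable_fun setT (fun w => (X i w, X j w)) by exact: measurable_fun_pair.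
pose XX : {mfun Om >-> (R * R)%type} := MeasurableFun.Pack
  (MeasurableFun.Class (isMeasurableFun.Build _ _ _ _ _ mXX)).
apply: (Rintegral_indic_indep (P := P) (U := XX)) => // A mA.
(* Uniqueness is applied to a law normalised by [mask_prob S]; if this number is 0, both sides
   vanish. *)
have [pz|pnz] := eqVneq (mask_prob S) 0.
  have : (P (mask_event S `&` XX @^-1` A) <= 0)%E.
    have := mask_prob_indep1 S i measurableT; rewrite pz mul0e preimage_setT setIT => <-.
    by apply: le_measure; rewrite ?inE//; apply: measurableI => //; exact: measurable_funPTI.
  by rewrite pz mul0e => h0; apply/eqP; rewrite eq_le h0 measure_ge0.
have pV : 0 <= (mask_prob S)^-1 by rewrite invr_ge0.
have [nu nuE] : exists nu : {measure set (R * R)%type -> \bar R}, forall B,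
    nu B = ((mask_prob S)^-1%:E * P (mask_event S `&` XX @^-1` B))%E.
  unshelve (refine (ex_intro _ (mscale (NngNum pV)
    (pushforward (mrestr P mE) XX : {measure set (R * R)%type -> \bar R})
    : {measure set (R * R)%type -> \bar R}) _)).
    exact: mXX.
  by move=> B /=; rewrite /mscale /= /pushforward /mrestr setIC.
have muA : (mu \x mu)%E A = nu A.
  apply: product_measure_unique => // B C mB mC; rewrite nuE.
  have -> : XX @^-1` (B `*` C) = X i @^-1` B `&` X j @^-1` C by [].
  by rewrite mask_prob_indep2// muleA -EFinM mulVf// mul1e.
transitivity ((mask_prob S)%:E * (mu \x mu) A)%E; last by [].
by rewrite muA nuE muleA -EFinM divff// mul1e.
Qed.

(** This is the squared RKHS norm of the mean embedding of [mu]. *)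
Let q := ipk k [:: (1, mu)] [:: (1, mu)].
Let K := Rintegral mu setT (fun x => k x x).

Lemma Rintegral_mask_kernel S i j :
  Rintegral P setT (fun w => \1_(mask_event S) w * k (X i w) (X j w)) =
  mask_prob S * (if i == j then K else q).
Proof.
case: eqVneq => [<-|ij].
  by rewrite (Rintegral_mask1 S i (f := fun x => k x x))//; exact: bmf_kernel_diag.
rewrite (Rintegral_mask2 S (h := fun p => k p.1 p.2))//; last exact: bmf_kernel2.
congr (_ * _); rewrite /q ipk1 /Rintegral; congr fine.
rewrite -(integral12_prod_meas1 (integrable_kernel2 k_meas k_bd mu mu)).
by apply: eq_integral => x _; rewrite lint1 -Rintegral_kernelE.
Qed.

(** This is the mean embedding of [mu], evaluated at [x]. *)
Let f x := lint [:: (1, mu)] (k x).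

Let bf : bmf f. Proof. exact: bmf_lint_kernel. Qed.

Lemma sqr_dist_atoms (x c : 'I_n -> R) :
  dist k (atoms x c) [:: (1, mu)] ^+ 2 =
  \sum_(i < n) \sum_(j < n) c i * c j * k (x i) (x j) +
  (\sum_(i < n) (- (2 * c i)) * f (x i) + q).
Proof.
rewrite sqr_nrm// ipk_scale_cat// -/q /atoms ipk_diracs// big_map.
under eq_bigr do rewrite big_map.
rewrite /ipk lint_diracs; last exact: bf.1.
rewrite big_map /= addrA; congr (_ + _ + _); last by rewrite expr2 mulrN1 opprK !mul1r.
by rewrite mulr_sumr; apply: eq_bigr => i _; rewrite -/(f _); ring.
Qed.

Let bk i j : bmf (fun w => k (X i w) (X j w)).
Proof.
have mXX : measurable_fun setT (fun w => (X i w, X j w)) by exact: measurable_fun_pair.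
exact: (bmf_comp mXX (bmf_kernel2 k_meas k_bd)).
Qed.

Let bfX i : bmf (fun w => f (X i w)).
Proof. exact: (bmf_comp (mX i) bf). Qed.

Lemma bmf_sqr_dist_atoms (c : 'I_n -> R) :
  bmf (fun w => dist k (atoms (X ^~ w) c) [:: (1, mu)] ^+ 2).
Proof.
under eq_fun do rewrite sqr_dist_atoms.
apply: bmfD; first by apply: bmf_sum => i; apply: bmf_sum => j; exact: bmfZ.
by apply: bmfD; [apply: bmf_sum => i; exact: bmfZ | exact: bmf_cst].
Qed.

(** A decomposition into bias and variance: the first summand measures how far the total weight is
    from 1, the second comes from the diagonal, where the kernel has mean [K] instead of [q]. *)
Lemma expected_sqr_dist_mask S (c : 'I_n -> R) : (0 < n)%N ->
  Rintegral P setT (fun w => \1_(mask_event S) w *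
    dist k (atoms (X ^~ w) c) [:: (1, mu)] ^+ 2) =
  mask_prob S * ((\sum_(i < n) c i - 1) ^+ 2 * q + (\sum_(i < n) c i ^+ 2) * (K - q)).
Proof.
move=> n0; have mE := measurable_mask_event S.
have bI (h : Om -> R) : bmf h -> bmf (fun w => \1_(mask_event S) w * h w) by exact: bmf_indicM.
have bIk i j : bmf (fun w => \1_(mask_event S) w * k (X i w) (X j w)).
  exact: (bI (fun w => k (X i w) (X j w))).
have bIf i : bmf (fun w => \1_(mask_event S) w * f (X i w)).
  exact: (bI (fun w => f (X i w))).
have bq : bmf (fun w => \1_(mask_event S) w * (1 : R)) by exact: (bI (fun=> 1) (bmf_cst 1)).
rewrite -lint1.
transitivity (lint [:: (1, P)] (fun w =>
    \sum_(i < n) \sum_(j < n) c i * c j * (\1_(mask_event S) w * k (X i w) (X j w)) +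
    (\sum_(i < n) (- (2 * c i)) * (\1_(mask_event S) w * f (X i w)) +
     q * (\1_(mask_event S) w * 1)))).
  apply: eq_lint => w; rewrite sqr_dist_atoms !mulrDr; congr (_ + (_ + _)).
  - rewrite mulr_sumr; apply: eq_bigr => i _; rewrite mulr_sumr.
    by apply: eq_bigr => j _; rewrite mulrCA.
  - by rewrite mulr_sumr; apply: eq_bigr => i _; rewrite mulrCA.
  - by rewrite mulr1 mulrC.
have b1 : bmf (fun w => \sum_(i < n) \sum_(j < n)
    c i * c j * (\1_(mask_event S) w * k (X i w) (X j w))).
  by apply: bmf_sum => i; apply: bmf_sum => j; exact: bmfZ.
have b2 : bmf (fun w => \sum_(i < n) (- (2 * c i)) * (\1_(mask_event S) w * f (X i w))).
  by apply: bmf_sum => i; exact: bmfZ.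
rewrite lintD//; last by apply: bmfD => //; exact: bmfZ.
rewrite lintD//; last exact: bmfZ.
(* The probability of the mask event is read off from the one-variable formula at a constant
   function; [0 < n] supplies the index. *)
have e0 : lint [:: (1, P)] (fun w => \1_(mask_event S) w * (1 : R)) = mask_prob S.
  rewrite lint1.
  have := Rintegral_mask1 S (Ordinal n0) (bmf_cst 1).
  by rewrite Rintegral_prob_cst mulr1.
rewrite lintZ// e0 lint_sum; last by move=> i; apply: bmf_sum => j; exact: bmfZ.
rewrite lint_sum; last by move=> i; exact: bmfZ.
have e1 i : lint [:: (1, P)] (fun w => \sum_(j < n)
      c i * c j * (\1_(mask_event S) w * k (X i w) (X j w))) =
    mask_prob S * (c i * (\sum_(j < n) c j) * q + c i ^+ 2 * (K - q)).
  rewrite lint_sum; last by move=> j; exact: bmfZ.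
  (* Every pair is first counted with [q]; the diagonal pair then receives the surplus [K - q]. *)
  transitivity (\sum_(j < n) (mask_prob S * c i * q * c j +
      (if j == i then mask_prob S * c i ^+ 2 * (K - q) else 0))).
    apply: eq_bigr => j _; rewrite lintZ// lint1 Rintegral_mask_kernel eq_sym.
    case: eqVneq => [->|_]; ring.
  rewrite big_split /= -mulr_sumr -big_mkcond big_pred1_eq; ring.
have e2 i : lint [:: (1, P)] (fun w => - (2 * c i) * (\1_(mask_event S) w * f (X i w))) =
    - (2 * mask_prob S * q) * c i.
  rewrite lintZ// lint1 Rintegral_mask1//.
  have -> : Rintegral mu setT f = q by rewrite /q ipk1.
  ring.
rewrite (eq_bigr _ (fun i _ => e1 i)) (eq_bigr _ (fun i _ => e2 i)).
rewrite -!mulr_sumr big_split /= -!mulr_suml; ring.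
Qed.

(** For nonempty [S] the weights sum to 1, so the bias vanishes, their squares sum to [1 / #|S|],
    and [K - q <= 1]. For empty [S] all weights are 0 and only [q <= 1] remains. *)
Lemma expected_sqr_dist_mask_weight S : (0 < n)%N ->
  Rintegral P setT (fun w => \1_(mask_event S) w *
    dist k (atoms (X ^~ w) (weight (fun i => i \notin S))) [:: (1, mu)] ^+ 2) <=
  mask_prob S / (maxn 1 #|S|)%:R.
Proof.
move=> n0; rewrite expected_sqr_dist_mask// ler_wpM2l ?mask_prob_ge0//.
have q0 : 0 <= q by exact: ipk_ge0.
have k1 x y : k x y <= 1 by rewrite (le_trans (ler_norm _)).
have q1 : q <= 1.
  rewrite /q ipk1; apply: bmf_le_Rintegral => [|x]; first exact: bmf_lint_kernel.
  by rewrite lint1; apply: bmf_le_Rintegral => //; exact: bmf_kernel.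
have K1 : K <= 1 by apply: bmf_le_Rintegral => //; exact: bmf_kernel_diag.
have uS : unmasked (fun i => i \notin S) = #|S|.
  by apply: eq_card => i; rewrite inE negbK.
have wE i : weight (fun i => i \notin S) i = (i \in S)%:R / (maxn 1 #|S|)%:R :> R.
  by rewrite /weight uS negbK.
have sS : \sum_(i < n) (i \in S)%:R = #|S|%:R :> R.
  by rewrite -sum1_card natr_sum [RHS]big_mkcond /=; apply: eq_bigr => i _; case: (i \in S).
have [S0|S0] := posnP #|S|.
  have w0 i : weight (fun i => i \notin S) i = 0 :> R.
    by rewrite wE (card0_eq S0) mul0r.
  rewrite (eq_bigr _ (fun i _ => w0 i)) big1// S0 sub0r.
  rewrite (eq_bigr (fun=> 0)); last by move=> i _; rewrite w0 expr0n.
  by rewrite big1// mul0r addr0 expr2 mulrN1 opprK mul1r invr1.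
rewrite (maxn_idPr S0) in wE *.
have Sn0 : #|S|%:R != 0 :> R by rewrite pnatr_eq0 -lt0n.
rewrite (eq_bigr _ (fun i _ => wE i)) -mulr_suml sS divff// subrr expr0n mul0r add0r.
rewrite (eq_bigr (fun i => (i \in S)%:R * (#|S|%:R^-1) ^+ 2)); last first.
  by move=> i _; rewrite wE exprMn; case: (i \in S); rewrite ?expr1n ?expr0n.
rewrite -mulr_suml sS expr2 mulrA divff// mul1r -[leRHS]mulr1 ler_wpM2l ?invr_ge0//.
lra.
Qed.

(** Exactly one mask event contains [w], that of its own observed set, and there the random weights
    agree with the fixed ones. *)
Lemma sqr_dist_weight_decomp w :
  dist k (atoms (X ^~ w) (weight (M ^~ w))) [:: (1, mu)] ^+ 2 =
  \sum_(S : {set 'I_n}) \1_(mask_event S) w *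
    dist k (atoms (X ^~ w) (weight (fun i => i \notin S))) [:: (1, mu)] ^+ 2.
Proof.
pose Sw : {set 'I_n} := [set i | ~~ M i w]%SET.
rewrite (bigD1 Sw)//= big1 ?addr0.
  rewrite indicE mem_set ?mul1r; last by move=> i _ /=; rewrite inE negbK.
  by congr (dist _ (atoms _ (weight _)) _ ^+ 2); apply/funext => i; rewrite inE negbK.
move=> S SSw; rewrite indicE memNset ?mul0r// => h; move/eqP: SSw; apply.
by apply/setP => i; have := h i I; rewrite inE /= => ->; rewrite negbK.
Qed.

Lemma bmf_sqr_dist_weight :
  bmf (fun w => dist k (atoms (X ^~ w) (weight (M ^~ w))) [:: (1, mu)] ^+ 2).
Proof.
under eq_fun do rewrite sqr_dist_weight_decomp.
apply: bmf_sum => S; apply: bmf_indicM; first exact: measurable_mask_event.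
exact: bmf_sqr_dist_atoms.
Qed.

Lemma expected_sqr_dist_weight : (0 < n)%N -> 0 < alpha ->
  Rintegral P setT (fun w =>
    dist k (atoms (X ^~ w) (weight (M ^~ w))) [:: (1, mu)] ^+ 2) <= 2 / (n%:R * alpha).
Proof.
move=> n0 a0; have /andP[_ a1] := alpha_bounds n0.
have a01 : 0 < alpha <= 1 by rewrite a0.
apply: le_trans (binomial_inverse_moment n0 a01).
rewrite -lint1; under eq_lint do rewrite sqr_dist_weight_decomp.
rewrite lint_sum; last first.
  move=> S; apply: bmf_indicM; first exact: measurable_mask_event.
  exact: bmf_sqr_dist_atoms.
by apply: ler_sum => S _; rewrite lint1; exact: expected_sqr_dist_mask_weight.
Qed.

End Sampling.

(* The integral of a nonnegative function, measurable or not, is the supremum of the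
   integrals of the simple functions below it. *)
Lemma ge0_le_integral_dominated {R : realType} {d} {T : measurableType d}
  (mu : {measure set T -> \bar R}) (f g : T -> \bar R) :
  (forall x, 0 <= f x)%E -> (forall x, f x <= g x)%E ->
  (\int[mu]_x f x <= \int[mu]_x g x)%E.
Proof.
move=> f0 fg; have g0 x : (0 <= g x)%E by exact: le_trans (fg x).
rewrite !ge0_integralTE//; apply: le_ereal_sup => _ [h /= hf <-].
by exists h => //= x; exact: le_trans (fg x).
Qed.

Lemma card_disagree {R : realType} (n : nat) (m m' : 'I_n -> bool) :
  #|[set i | m' i != m i]%classic|%:R = \sum_(i < n) (m' i != m i)%:R :> R.
Proof.
rewrite -sum1_card natr_sum big_mkcond /=; apply: eq_bigr => i _.
have -> : (i \in [set i | m' i != m i]%classic) = (m' i != m i).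
  by apply/idP/idP => [/set_mem|/mem_set].
by case: (m' i != m i).
Qed.

Theorem theorem12 (R : realType) (Theta : Type) (Pm : Theta -> probability R R)
  (k : R -> R -> R)
  (k_meas : kernel_measurable k) (k_pd : pos_def_kernel k)
  (k_bd : kernel_bounded_by_1 k) (k_char : characteristic k)
  (d : measure_display) (Omega : measurableType d) (P : probability Omega R)
  (n : nat) (X : 'I_n -> Omega -> R) (M : 'I_n -> Omega -> bool)
  (theta_star : Theta) (QX : probability R R) (eps alpha veps : R) :
  (0 < n)%N -> 0 <= eps <= 1 -> 0 < veps -> veps < alpha ->
  MCAR_sample P X M
    (fun A => ((1 - eps)%:E * Pm theta_star A + eps%:E * QX A)%E) alpha ->
  forall Mt : Omega -> 'I_n -> bool,
  (forall w, #|[set i | Mt w i != M i w]|%:R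
             <= #|[set i | ~~ M i w]|%:R * veps / alpha) ->
  forall theta_hat : Omega -> Theta,
  (forall w (th : Theta),
     MMD k (emp (fun i => X i w) (Mt w)) (Pm (theta_hat w))
     <= MMD k (emp (fun i => X i w) (Mt w)) (Pm th)) ->
  (\int[P]_w (MMD k (Pm theta_star) (Pm (theta_hat w)))%:E
   <= (4 * eps + 6 * veps / (alpha - veps)
       + 2 * Num.sqrt 2 / Num.sqrt (n%:R * alpha))%:E)%E.
Proof.
move=> n0 eps01 v0 va sample Mt hMt theta_hat hth.
have a0 : 0 < alpha by exact: lt_trans va.
have va0 : 0 < alpha - veps by rewrite subr_gt0.
have np : 0 < n%:R :> R by rewrite ltr0n.
pose i0 := Ordinal n0.
case: (sample) => mX mM indep lawX lawM.
pose X0 : {mfun Omega >-> R} := MeasurableFun.Pack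
  (MeasurableFun.Class (isMeasurableFun.Build _ _ _ _ _ (mX i0))).
(* The mixture is given only as a set function; as the law of one observation it becomes a
   [probability]. *)
pose mu : probability R R := distribution P X0.
have muE A : measurable A ->
    mu A = ((1 - eps)%:E * Pm theta_star A + eps%:E * QX A)%E by exact: (lawX i0).
have sample' : MCAR_sample P X M mu alpha.
  by split => // i A mA; rewrite lawX// muE.
pose star := [:: (1 : R, Pm theta_star)].
pose dev w := dist k (atoms (X ^~ w) (weight (M ^~ w))) [:: (1, mu)].
(* [t ^+ 2] is the bound on the mean of [dev ^+ 2], and [2 * t] is the last term of the goal. *)
pose t := Num.sqrt (2 / (n%:R * alpha)).
have t0 : 0 < t by rewrite sqrtr_gt0 divr_gt0// mulr_gt0.
pose delta := veps / alpha.
have delta01 : 0 <= delta < 1.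
  by rewrite divr_ge0 ?ltW//= /delta ltr_pdivrMr// mul1r.
pose c := 4 * eps + 4 * veps / (alpha - veps) + t.
(* The minimiser's inequality doubles each of the three errors. The bound is quadratic in [dev], so
   that only a second moment has to be integrated. *)
have bound w : MMD k (Pm theta_star) (Pm (theta_hat w)) <= c + t^-1 * dev w ^+ 2.
  set x := X ^~ w; set e := atoms x (weight (Mt w)).
  pose hat := [:: (1 : R, Pm (theta_hat w))].
  have rep th := MMD_represents k_meas k_pd k_bd (represents_emp x (Mt w))
    (represents_prob (Pm th)).
  rewrite (MMD_represents k_meas k_pd k_bd (represents_prob _) (represents_prob _)).
  rewrite -/star -/hat.
  have h1 : dist k e hat <= dist k e star by rewrite -!rep; exact: hth.
  have h2 := dist_triangle k_meas k_pd k_bd e star hat.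
  have h3 := dist_triangle k_meas k_pd k_bd (atoms x (weight (M ^~ w))) e star.
  have h4 := dist_triangle k_meas k_pd k_bd [:: (1, mu)] (atoms x (weight (M ^~ w))) star.
  have h5 : dist k [:: (1, mu)] star <= 2 * eps by exact: (dist_mixture k_meas k_bd eps01 muE).
  have h6 : dist k e (atoms x (weight (M ^~ w))) <= 2 * (veps / (alpha - veps)).
    apply: le_trans (dist_atoms k_meas k_bd _ _ _) _.
    have -> : veps / (alpha - veps) = delta / (1 - delta).
      by rewrite /delta; field; rewrite !gt_eqF//=.
    apply: weight_perturbation => //.
    by have := hMt w; rewrite card_disagree card_unmasked mulrA.
  rewrite (dist_sym k_meas k_bd star e) in h2.
  (* Expanding the square of [dev w - t] gives a pointwise substitute for Jensen's inequality. *)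
  have h7 : 2 * dev w <= t + t^-1 * dev w ^+ 2.
    have : 0 <= t^-1 * (dev w - t) ^+ 2 by rewrite mulr_ge0 ?invr_ge0 ?sqr_ge0// ltW.
    have -> : t^-1 * (dev w - t) ^+ 2 = t + t^-1 * dev w ^+ 2 - 2 * dev w.
      by field; rewrite gt_eqF.
    lra.
  move: h7; rewrite /dev -/x /c => h7.
  have -> : 4 * veps / (alpha - veps) = 4 * (veps / (alpha - veps)) by rewrite mulrA.
  lra.
(* The adversary and the minimiser are arbitrary functions of [w], so the integrand may fail to be
   measurable; its majorant is measurable. *)
apply: le_trans (ge0_le_integral_dominated (g := fun w => (c + t^-1 * dev w ^+ 2)%:E) _ _ _) _.
- by move=> w; rewrite lee_fin sqrtr_ge0.
- by move=> w; rewrite lee_fin.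
have bdev : bmf (fun w => dev w ^+ 2) by exact: (bmf_sqr_dist_weight k_meas k_pd k_bd sample').
have bg : bmf (fun w => c + t^-1 * dev w ^+ 2) by apply: bmfD; [exact: bmf_cst | exact: bmfZ].
have -> : (\int[P]_w (c + t^-1 * dev w ^+ 2)%:E)%E =
    (Rintegral P setT (fun w => c + t^-1 * dev w ^+ 2))%:E.
  by rewrite /Rintegral fineK//; apply: integrable_fin_num => //; exact: bmf_integrable_prob.
rewrite lee_fin -lint1 lintD; [|exact: bmf_cst|exact: bmfZ].
rewrite lintZ// !lint1 Rintegral_prob_cst.
have hdev := expected_sqr_dist_weight k_meas k_pd k_bd sample' n0 a0.
have tE : 2 / (n%:R * alpha) = t ^+ 2 by rewrite sqr_sqrtr// divr_ge0// mulr_ge0// ltW.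
have : t^-1 * Rintegral P setT (fun w => dev w ^+ 2) <= t.
  by rewrite ler_pdivrMl// -expr2 -tE.
have -> : 2 * Num.sqrt 2 / Num.sqrt (n%:R * alpha) = 2 * t.
  by rewrite /t [in RHS]sqrtrM// sqrtrV ?mulrA// mulr_ge0// ltW.
(* The estimates give the factor 4 in front of this quotient; its nonnegativity allows the factor 6
   of the goal. *)
have : 0 <= veps / (alpha - veps) by rewrite divr_ge0// ltW.
have -> : 6 * veps / (alpha - veps) = 6 * (veps / (alpha - veps)) by rewrite mulrA.
rewrite /c; have -> : 4 * veps / (alpha - veps) = 4 * (veps / (alpha - veps)) by rewrite mulrA.
lra.
Qed.
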